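(* Let $H$ be a countable group. Then $H$ is computable if and only if $H$ is (isomorphic to) a subgroup of a finitely generated group $G$ with decidable word problem such that the membership problem for the subgroup $H$ in $G$ is decidable. The same equivalence holds with ''subgroup'' replaced by ''subnormal subgroup''.
   Context: A countable group $H$ is computable if there is a countable enumerated generating set $X=\{x_1,x_2,\ldots\}$ (finite or infinite) of $H$ such that $\{u\in (X\cup X^{-1})^*\mid u=_H1\}$ is recursive, where $(X\cup X^{-1})^*$ is the set of finite words in the formal letters $x_i^{\pm1}$ and recursiveness is understood via the indices of the letters. A finitely generated group $G$ has decidable word problem if this holds for a finite generating set $S$ of $G$ (equivalently for every finite generating set). The membership problem for $H\le G$ is decidable if there is an algorithm deciding, for a word over $S\cup S^{-1}$, whether the element of $G$ it represents lies in $H$. *)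

(* Defs.v *)
(* Built on MathComp: [groupType] is the library's type of arbitrary, possibly
   infinite, multiplicative groups. *)
From mathcomp Require Import all_boot.

Set Implicit Arguments.
Unset Strict Implicit.
Unset Printing Implicit Defensive.

Local Open Scope group_scope.

(* The total recursive functions nat^k -> nat in the sense of Goedel and Kleene;
   minimization is only applied to regular functions, so partial functions never
   occur. The equations are stated pointwise, hence the class is closed under
   extensional equality. *)
Inductive recursive : forall k, (k.-tuple nat -> nat) -> Prop :=
| recursive_zero : recursive (fun _ : 0.-tuple nat => 0%N)
| recursive_succ : recursive (fun t : 1.-tuple nat => (thead t).+1)
| recursive_proj k (i : 'I_k) : recursive (fun t : k.-tuple nat => tnth t i)
| recursive_comp k m (g : m.-tuple nat -> nat)
    (f : 'I_m -> k.-tuple nat -> nat) (h : k.-tuple nat -> nat) :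
    recursive g -> (forall i, recursive (f i)) ->
    (forall t, h t = g [tuple f i t | i < m]) ->
    recursive h
| recursive_primrec k (f : k.-tuple nat -> nat) (g : k.+2.-tuple nat -> nat)
    (h : k.+1.-tuple nat -> nat) :
    recursive f -> recursive g ->
    (forall t : k.-tuple nat, h [tuple of 0%N :: t] = f t) ->
    (forall (n : nat) (t : k.-tuple nat), h [tuple of n.+1 :: t] =
                 g [tuple of n :: h [tuple of n :: t] :: t]) ->
    recursive h
| recursive_min k (f : k.+1.-tuple nat -> nat) (h : k.-tuple nat -> nat) :
    recursive f ->
    (forall t : k.-tuple nat, f [tuple of h t :: t] = 0%N) ->
    (forall (t : k.-tuple nat) (n : nat),
       (n < h t)%N -> f [tuple of n :: t] <> 0%N) ->
    recursive h.

Definition recursive_pred (chi : nat -> bool) : Prop :=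
  recursive (fun t : 1.-tuple nat => nat_of_bool (chi (thead t))).

(* The pair (i, e) is the formal letter x_i when e is false and x_i^-1 when e is
   true. *)
Definition word (I : Type) : Type := seq (I * bool).

(* [idx i] is the numerical index of the letter i. *)
Definition word_code (I : Type) (idx : I -> nat) (w : word I) : nat :=
  CodeSeq.code [seq ((idx l.1).*2 + l.2)%N | l : I * bool <- w].

Definition recursive_language (I : Type) (idx : I -> nat)
    (L : word I -> Prop) : Prop :=
  exists2 chi : nat -> bool, recursive_pred chi &
    forall w : word I, L w <-> chi (word_code idx w).

Definition word_eval (G : groupType) (I : Type) (x : I -> G) (w : word I) : G :=
  \prod_(l <- w) (if l.2 then (x l.1)^-1 else x l.1).

Definition generates (G : groupType) (I : Type) (x : I -> G) : Prop :=
  forall g : G, exists w : word I, word_eval x w = g.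

Definition countable_group (H : groupType) : Prop :=
  exists f : H -> nat, injective f.

(* An enumerated generating set is finite, x_0, ..., x_(n-1), or infinite,
   x_0, x_1, ...; the enumeration may have repetitions. *)
Definition computable_group (H : groupType) : Prop :=
  (exists (n : nat) (x : 'I_n -> H), generates x /\
     recursive_language (@nat_of_ord n) (fun w => word_eval x w = 1))
  \/
  (exists x : nat -> H, generates x /\
     recursive_language id (fun w => word_eval x w = 1)).

Definition finitely_generated (G : groupType) : Prop :=
  exists (n : nat) (s : 'I_n -> G), generates s.

Definition decidable_word_problem (G : groupType) : Prop :=
  exists (n : nat) (s : 'I_n -> G), generates s /\
    recursive_language (@nat_of_ord n) (fun w => word_eval s w = 1).

Definition decidable_membership (G : groupType) (K : {pred G}) : Prop :=
  exists (n : nat) (s : 'I_n -> G), generates s /\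
    recursive_language (@nat_of_ord n) (fun w => word_eval s w \in K).

Definition isomorphic_to_subgroup (H G : groupType) (K : {pred G}) : Prop :=
  group_closed K /\
  exists phi : {multiplicative H -> G},
    injective phi /\ forall g : G, g \in K <-> exists h : H, phi h = g.

Definition normal_subgroup (G : groupType) (A B : {pred G}) : Prop :=
  [/\ group_closed A, group_closed B, {subset A <= B}
    & {in A & B, forall a b, a ^ b \in A}].

Definition subnormal_subgroup (G : groupType) (K : {pred G}) : Prop :=
  exists (m : nat) (C : nat -> {pred G}),
    [/\ C 0%N =i K, C m =i predT
      & forall i, (i < m)%N -> normal_subgroup (C i) (C i.+1)].

(* Main.v *)
From HB Require Import structures.
Require Import Defs.
From mathcomp Require Import all_boot all_order ssralg ssrnum ssrint zify.
From mathcomp Require boolp.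

(** If H is a subgroup of a finitely generated group G and both problems are
    decidable in G, then the words of G that represent elements of H can be
    listed, and the resulting generators of H inherit the word problem of G
    ([computable_group_of_overgroup]).

    Conversely, let y be a sequence that generates H, with y_0 = 1, and for
    which triviality of words is decidable. Consider three permutations of the
    triples (p, q, h) in Z x Z x H: s moves p by one; t moves q by one where
    p = 0; b moves q by one where p = j^2, and there also multiplies h by y_j
    when q is nonnegative. They generate G. Conjugating b by s^(j^2) brings
    the position j^2 to 0, where the commutator with t is multiplication by y_j
    at (0, 0) alone ([point_mass_gen]). Hence G contains the copy of H that
    acts at (0, 0), and this copy is subnormal: it is normal among the elements
    that fix p and also fix q where p = 0, these are normal among those that fix
    p, and these are normal in G.

    A word of length n moves (p, q, h) to (p + c, q + d(p), h * e(p, q)), where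
    e(p, q) is an explicit word in y. It represents 1 when c, d and e are
    trivial, and an element of the copy of H when they are trivial except for
    e(0, 0). Both conditions need only be tested at finitely many (p, q)
    ([trivial_near]). A far p sees at most one square within distance n, since
    the gaps between squares grow. The pattern of hits around p also occurs
    around a near p', so d(p) = d(p') ([eq_turn], [far_window]); and with a
    single square all factors of e(p, q) are powers of the same y_j and
    telescope, so that e(p, q) = 1 once d(p) = 0 ([fibre_single]). This is why b
    moves q: without it the test at far positions would ask whether a power of
    y_j is trivial for all large j. The remaining parameter q matters only
    through signs.

    The test is shown to be recursive through a notion of computable function
    between countable types that is closed under pairing, case analysis and
    iteration over lists. *)

Set Implicit Arguments.
Unset Strict Implicit.
Unset Printing Implicit Defensive.
Import Order.TTheory Num.Theory.

(** * Recursive functions of several numbers *)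

Definition recursive1 (f : nat -> nat) :=
  recursive (fun t : 1.-tuple nat => f (thead t)).

Definition recursive2 (f : nat -> nat -> nat) :=
  recursive (fun t : 2.-tuple nat => f (tnth t ord0) (tnth t ord_max)).

Lemma eq_recursive k (f g : k.-tuple nat -> nat) :
  f =1 g -> recursive f -> recursive g.
Proof.
move=> fg rf.
apply: (recursive_comp (f := fun i t => tnth t i) rf) => [i|t].
  exact: recursive_proj.
by rewrite -fg; congr f; apply: eq_from_tnth => i; rewrite tnth_mktuple.
Qed.

Lemma recursive1_comp k f (g : k.-tuple nat -> nat) :
  recursive1 f -> recursive g -> recursive (fun t => f (g t)).
Proof.
move=> rf rg; apply: (recursive_comp (f := fun=> g) rf) => // t.
by rewrite /thead tnth_mktuple.
Qed.

Lemma recursive2_comp k f (g h : k.-tuple nat -> nat) :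
  recursive2 f -> recursive g -> recursive h ->
  recursive (fun t => f (g t) (h t)).
Proof.
move=> rf rg rh.
apply: (recursive_comp (f := fun i : 'I_2 => if i == ord0 then g else h) rf).
  by move=> i; case: ifP.
by move=> t; rewrite !tnth_mktuple.
Qed.

Lemma recursive_const k n : recursive (fun _ : k.-tuple nat => n).
Proof.
elim: n => [|n IHn].
  have zero := recursive_comp (f := fun i : 'I_0 => fun=> 0) recursive_zero.
  by apply: zero => [[]|].
exact: (recursive1_comp recursive_succ IHn).
Qed.

(** Primitive recursion with a single parameter suffices: further parameters
    are coded into one number. *)
Lemma recursive2_primrec (f : nat -> nat) (g : nat -> nat -> nat -> nat) h :
  recursive1 f ->
  recursive (fun t : 3.-tuple nat =>
    g (tnth t ord0) (tnth t (inord 1)) (tnth t ord_max)) ->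
  (forall e, h 0 e = f e) -> (forall n e, h n.+1 e = g n (h n e) e) ->
  recursive2 h.
Proof.
move=> rf rg h0 hS; apply: (recursive_primrec rf rg) => [t|n t].
  by case/tupleP: t => e t; rewrite /thead !(tnth_nth 0) /= h0.
case/tupleP: t => e t.
by rewrite !(tnth_nth 0) /= hS inordK.
Qed.

Lemma recursive1_primrec a (g : nat -> nat -> nat) h :
  recursive2 g -> h 0 = a -> (forall n, h n.+1 = g n (h n)) -> recursive1 h.
Proof.
move=> rg h0 hS.
have r2 : recursive2 (fun n (_ : nat) => h n).
  apply: (@recursive2_primrec (fun=> a) (fun n c _ => g n c)) => //.
    exact: recursive_const.
  by apply: recursive2_comp => //; apply: recursive_proj.
apply: (recursive2_comp r2); first exact: recursive_proj.
exact: (recursive_const 1 0).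
Qed.

Lemma recursive2_add : recursive2 addn.
Proof.
apply: (@recursive2_primrec id (fun n c e => c.+1)) => //.
  exact: recursive_proj.
by apply: (recursive1_comp recursive_succ); apply: recursive_proj.
Qed.

Lemma recursive1_eq0 : recursive1 (fun n => n == 0).
Proof.
apply: (@recursive1_primrec 1 (fun _ _ => 0)) => //.
exact: recursive_const.
Qed.

(** The branches are combined as a sum of two functions that are zero when
    their branch is not selected. *)
Lemma recursive_if k (b : k.-tuple nat -> bool) (f g : k.-tuple nat -> nat) :
  recursive (fun t => b t : nat) -> recursive f -> recursive g ->
  recursive (fun t => if b t then f t else g t).
Proof.
move=> rb rf rg.
pose h := fun n (e : nat) => if n is 0 then 0 else e.
have rh : recursive2 h.
  apply: (@recursive2_primrec (fun=> 0) (fun n c e => e)) => //.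
    exact: recursive_const.
  exact: recursive_proj.
pose h' := fun n (e : nat) => if n is 0 then e else 0.
have rh' : recursive2 h'.
  apply: (@recursive2_primrec id (fun n c e => 0)) => //.
    exact: recursive_proj.
  exact: recursive_const.
apply: (eq_recursive _ (recursive2_comp recursive2_add
  (recursive2_comp rh rb rf) (recursive2_comp rh' rb rg))) => t.
by rewrite /h /h' /=; case: (b t); rewrite ?addn0.
Qed.

Lemma recursive1_odd : recursive1 (fun n => odd n).
Proof.
apply: (@recursive1_primrec 0 (fun _ c => if c is 0 then 1 else 0)) => //.
  apply: (@eq_recursive _ (fun t : 2.-tuple nat =>
      if tnth t ord_max == 0 then 1 else 0)).
    by move=> t; case: (tnth _ _).
  apply: recursive_if; [|exact: recursive_const..].
  by apply: (recursive1_comp recursive1_eq0); apply: recursive_proj.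
by move=> n /=; case: (odd n).
Qed.

Lemma recursive1_double : recursive1 double.
Proof.
apply: (@eq_recursive _ (fun t : 1.-tuple nat => thead t + thead t)).
  by move=> t; rewrite addnn.
by apply: (recursive2_comp recursive2_add); apply: recursive_proj.
Qed.

Lemma recursive1_half : recursive1 half.
Proof.
apply: (@recursive1_primrec 0 (fun n c => odd n + c)) => //; last first.
  by move=> n; rewrite -uphalfE uphalf_half.
apply: (recursive2_comp recursive2_add); last exact: recursive_proj.
by apply: (recursive1_comp recursive1_odd); apply: recursive_proj.
Qed.

(** One step of the coding of lists by numbers in [CodeSeq]. It is a bijection
    from pairs of numbers to positive numbers, so it also serves as a pairing
    function. *)
Definition code_cons a b := 2 ^ a * b.*2.+1.

Lemma recursive2_cons : recursive2 code_cons.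
Proof.
apply: (@recursive2_primrec (fun b => b.*2.+1) (fun _ c _ => c.*2)).
- exact: (recursive1_comp recursive_succ recursive1_double).
- by apply: (recursive1_comp recursive1_double); apply: recursive_proj.
- by move=> b; rewrite /code_cons mul1n.
- by move=> a b; rewrite /code_cons expnS -mulnA mul2n.
Qed.

(** In [2 ^ a * (2 * b + 1)], [a] is the number of halvings before an odd
    number appears, and [b] is what one more halving leaves. *)
Definition code_head c := if c is 0 then 0 else logn 2 c.
Definition code_tail c := (iter (code_head c) half c)./2.

Lemma code_consK1 a b : code_head (code_cons a b) = a.
Proof.
have c0 : 0 < code_cons a b by rewrite muln_gt0 expn_gt0.
rewrite /code_head; case E: (code_cons a b) c0 => [|c] // _.
rewrite -E lognM ?expn_gt0 // pfactorK // logn_coprime ?addn0 //.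
by rewrite coprime2n /= odd_double.
Qed.

Lemma iter_half a b : iter a half (2 ^ a * b) = b.
Proof.
elim: a b => [|a IHa] b; first by rewrite mul1n.
by rewrite iterSr expnS -mulnA mul2n doubleK.
Qed.

Lemma code_consK2 a b : code_tail (code_cons a b) = b.
Proof.
rewrite /code_tail code_consK1 iter_half.
by rewrite -uphalfE uphalf_double.
Qed.

Lemma code_cons_neq0 a b : (code_cons a b == 0) = false.
Proof. by rewrite muln_eq0 expn_eq0. Qed.

Lemma recursive2_iter_half : recursive2 (fun n c => iter n half c).
Proof.
apply: (@recursive2_primrec id (fun _ c _ => half c)) => //.
  exact: recursive_proj.
by apply: (recursive1_comp recursive1_half); apply: recursive_proj.
Qed.

(** The head is found by minimization: it is the least number of halvings that
    produces an odd number. The code zero is stopped at once, which makes the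
    minimized function regular. *)
Lemma recursive1_head : recursive1 code_head.
Proof.
apply: (@recursive_min 1 (fun t : 2.-tuple nat =>
   if tnth t ord_max == 0 then 0 else
   if odd (iter (tnth t ord0) half (tnth t ord_max)) then 0 else 1)).
- apply: recursive_if.
  + by apply: (recursive1_comp recursive1_eq0); apply: recursive_proj.
  + exact: recursive_const.
  apply: recursive_if; [|exact: recursive_const..].
  apply: (recursive1_comp recursive1_odd).
  by apply: (recursive2_comp recursive2_iter_half); apply: recursive_proj.
- case/tupleP=> c t; rewrite /thead !(tnth_nth 0) /=.
  case: c => [|c] //=.
  have: 0 < c.+1 by [].
  move: (c.+1) => {}c c0.
  have [m [cm mo]]: exists m, c = 2 ^ logn 2 c * m /\ odd m.
    exists (c %/ 2 ^ logn 2 c); split.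
      by rewrite mulnC divnK // pfactor_dvdnn.
    have := pfactor_coprime (isT : prime 2) c0 => -[m].
    rewrite coprime2n => mo cE.
    by rewrite {1}cE mulnK ?expn_gt0.
  by move: (logn 2 c) cm => a ->; rewrite iter_half mo.
case/tupleP=> c t n; rewrite /thead !(tnth_nth 0) /=.
case: c => [|c] //.
rewrite /code_head -pfactor_dvdn //= => /dvdnP [m ->].
by rewrite mulnC expnSr -mulnA mul2n iter_half odd_double.
Qed.

Lemma recursive1_tail : recursive1 code_tail.
Proof.
apply: (recursive1_comp recursive1_half).
apply: (recursive2_comp recursive2_iter_half recursive1_head).
exact: recursive_proj.
Qed.

(** * Computable functions between countable types *)

(** Computability of a typed function, through the canonical numbering of its
    domain and codomain. A number, a list of numbers and a boolean are numbered
    by themselves, by [CodeSeq.code] and by 0 or 1, so this agrees with the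
    conventions of [recursive_language]. *)
Definition computable (A B : countType) (f : A -> B) :=
  exists2 F, recursive1 F & forall a, F (pickle a) = pickle (f a).

Lemma pickle_pair (A B : countType) (a : A) (b : B) :
  pickle (a, b) = code_cons (pickle a) (code_cons (pickle b) 0).
Proof. by []. Qed.

Lemma pickle_cons (T : countType) (x : T) (s : seq T) :
  pickle (x :: s) = code_cons (pickle x) (pickle s).
Proof. by []. Qed.

Lemma pickle_Posz n :
  pickle (Posz n) = code_cons (code_cons n 0) (code_cons 0 0).
Proof. by []. Qed.

Lemma pickle_Negz n :
  pickle (Negz n) = code_cons 0 (code_cons (code_cons n 0) 0).
Proof. by []. Qed.

Section Closure.
Variables (E : countType).

Lemma eq_computable (A : countType) (f g : E -> A) :
  f =1 g -> computable f -> computable g.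
Proof. by move=> fg [F rF FE]; exists F => // a; rewrite FE fg. Qed.

Lemma computable_id : computable (fun e : E => e).
Proof. by exists id => //; apply: recursive_proj. Qed.

Lemma computable_const (A : countType) (a : A) : computable (fun _ : E => a).
Proof. by exists (fun=> pickle a) => //; apply: recursive_const. Qed.

Lemma computable_comp (A B : countType) (g : A -> B) (f : E -> A) :
  computable g -> computable f -> computable (fun e => g (f e)).
Proof.
move=> [G rG GE] [F rF FE]; exists (fun n => G (F n)); last first.
  by move=> e; rewrite FE GE.
exact: (recursive1_comp rG rF).
Qed.

Lemma computable_pair (A B : countType) (f : E -> A) (g : E -> B) :
  computable f -> computable g -> computable (fun e => (f e, g e)).
Proof.
move=> [F rF FE] [G rG GE].
exists (fun n => code_cons (F n) (code_cons (G n) 0)); last first.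
  by move=> e; rewrite FE GE.
apply: (recursive2_comp recursive2_cons rF).
exact: (recursive2_comp recursive2_cons rG (recursive_const _ 0)).
Qed.

Lemma computable_fst (A B : countType) (f : E -> A * B) :
  computable f -> computable (fun e => (f e).1).
Proof.
move=> [F rF FE]; exists (fun n => code_head (F n)); last first.
  by move=> e; rewrite FE; case: (f e) => a b; rewrite pickle_pair code_consK1.
exact: (recursive1_comp recursive1_head rF).
Qed.

Lemma computable_snd (A B : countType) (f : E -> A * B) :
  computable f -> computable (fun e => (f e).2).
Proof.
move=> [F rF FE]; exists (fun n => code_head (code_tail (F n))); last first.
  move=> e; rewrite FE; case: (f e) => a b.
  by rewrite pickle_pair code_consK2 code_consK1.
exact: (recursive1_comp recursive1_head (recursive1_comp recursive1_tail rF)).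
Qed.

Lemma computable_if (A : countType) (b : E -> bool) (f g : E -> A) :
  computable b -> computable f -> computable g ->
  computable (fun e => if b e then f e else g e).
Proof.
move=> [B rB BE] [F rF FE] [G rG GE].
exists (fun n => if B n == 0 then G n else F n); last first.
  by move=> e; rewrite BE GE FE; case: (b e).
apply: recursive_if => //.
exact: (recursive1_comp recursive1_eq0 rB).
Qed.

Lemma computable_cons (T : countType) (x : E -> T) (s : E -> seq T) :
  computable x -> computable s -> computable (fun e => x e :: s e).
Proof.
move=> [F rF FE] [G rG GE]; exists (fun n => code_cons (F n) (G n)); last first.
  by move=> e; rewrite FE GE.
exact: (recursive2_comp recursive2_cons rF rG).
Qed.

Lemma computable_nat1 (f : nat -> nat) (g : E -> nat) :
  recursive1 f -> computable g -> computable (fun e => f (g e)).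
Proof. by move=> rf; apply: computable_comp; exists f. Qed.

Lemma computable_nat2 (f : nat -> nat -> nat) (g h : E -> nat) :
  recursive2 f -> computable g -> computable h ->
  computable (fun e => f (g e) (h e)).
Proof.
move=> rf [G rG GE] [F rF FE]; exists (fun n => f (G n) (F n)).
  exact: (recursive2_comp rf rG rF).
by move=> e; rewrite GE FE.
Qed.

(** The variables [e] in scope travel with the state as a pair, and the step is
    a computable function of that pair: this is how an open term is iterated. *)
Lemma computable_iter (A : countType) (n : E -> nat) (f : E -> A)
    (g : E -> A -> A) :
  computable n -> computable f ->
  computable (fun u : E * A => g u.1 u.2) ->
  computable (fun e => iter (n e) (g e) (f e)).
Proof.
move=> [N rN NE] [F rF FE] [G rG GE].
pose h n e := iter n (fun a => G (code_cons e (code_cons a 0))) (F e).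
have rh : recursive2 h.
  apply: (@recursive2_primrec F
    (fun _ a e => G (code_cons e (code_cons a 0)))) => //.
  apply: (recursive1_comp rG).
  apply: (recursive2_comp recursive2_cons); first exact: recursive_proj.
  apply: (recursive2_comp recursive2_cons); first exact: recursive_proj.
  exact: recursive_const.
exists (fun c => h (N c) c).
  by apply: (recursive2_comp rh rN); apply: recursive_proj.
move=> e; rewrite NE /h FE /=; elim: (n e) => //= m ->.
by rewrite -pickle_pair GE.
Qed.

Lemma computable_list_case (T A : countType) (s : E -> seq T) (f : E -> A)
    (g : E -> T -> seq T -> A) :
  computable s -> computable f ->
  computable (fun u : E * T * seq T => g u.1.1 u.1.2 u.2) ->
  computable (fun e => if s e is x :: s' then g e x s' else f e).
Proof.
move=> [S rS SE] [F rF FE] [G rG GE].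
exists (fun n => if S n == 0 then F n else
  G (code_cons (code_cons n (code_cons (code_head (S n)) 0))
       (code_cons (code_tail (S n)) 0))); last first.
  move=> e; rewrite SE FE; case: (s e) => //= x s'.
  rewrite pickle_cons code_cons_neq0 code_consK1 code_consK2.
  by rewrite -!pickle_pair GE.
apply: recursive_if => //; first exact: (recursive1_comp recursive1_eq0 rS).
apply: (recursive1_comp rG).
have r0 := recursive_const 1 0.
apply: (recursive2_comp recursive2_cons).
  apply: (recursive2_comp recursive2_cons); first exact: recursive_proj.
  apply: (recursive2_comp recursive2_cons) => //.
  exact: (recursive1_comp recursive1_head).
apply: (recursive2_comp recursive2_cons) => //.
exact: (recursive1_comp recursive1_tail).
Qed.

End Closure.

(** Proves that an open term is computable by recursion on its syntax; it is
    extended below as the stock of computable operations grows. *)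
Ltac computable_step :=
  cbv beta; lazymatch goal with
  | |- computable (fun e => e) => apply: computable_id
  | |- computable fst => exact: (computable_fst (computable_id _))
  | |- computable snd => exact: (computable_snd (computable_id _))
  | |- computable (fun e => (@?f e, @?g e)) =>
      refine (@computable_pair _ _ _ f g _ _)
  | |- computable (fun e => (@?f e).1) => refine (@computable_fst _ _ _ f _)
  | |- computable (fun e => (@?f e).2) => refine (@computable_snd _ _ _ f _)
  end.

Lemma size_pickle (T : countType) (s : seq T) : size s <= pickle s.
Proof.
elim: s => //= x s IHs; rewrite pickle_cons.
apply: leq_trans (_ : (pickle s).+1 <= _) => //.
apply: (@leq_trans (pickle s).*2.+1).
  by rewrite ltnS -addnn leq_addr.
by rewrite leq_pmull // expn_gt0.
Qed.

(** The pair of the accumulator and the rest of the list is iterated. The code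
    of a list bounds its length, so it is a sufficient number of iterations. *)
Lemma computable_foldl (E A T : countType) (f : E -> A) (s : E -> seq T)
    (g : E -> A -> T -> A) :
  computable f -> computable s ->
  computable (fun u : E * A * T => g u.1.1 u.1.2 u.2) ->
  computable (fun e => foldl (g e) (f e) (s e)).
Proof.
move=> cf cs cg.
pose step e (u : A * seq T) :=
  if u.2 is x :: s' then (g e u.1 x, s') else u.
have stepE e n a l :
    size l <= n -> (iter n (step e) (a, l)).1 = foldl (g e) a l.
  elim: n a l => [|n IHn] a [|x l] //=; last first.
    by rewrite -iterS iterSr; apply: IHn.
  move=> _; suff -> : iter n (step e) (a, [::]) = (a, [::]) by [].
  by elim: n {IHn} => //= n ->.
apply: (@eq_computable _ _
  (fun e => (iter (pickle (s e)) (step e) (f e, s e)).1)).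
  by move=> e; rewrite stepE // size_pickle.
apply: computable_fst; apply: computable_iter.
- by case: cs => S rS SE; exists S.
- exact: computable_pair.
apply: computable_list_case.
- by repeat computable_step.
- by repeat computable_step.
computable_step; last by repeat computable_step.
pose k (u : E * (A * seq T) * T * seq T) := (u.1.1.1, u.1.1.2.1, u.1.2).
by apply: (computable_comp (f := k) cg); rewrite /k; repeat computable_step.
Qed.

Lemma computable_succ (E : countType) (f : E -> nat) :
  computable f -> computable (fun e => (f e).+1).
Proof. exact: (computable_nat1 recursive_succ). Qed.

Lemma computable_half (E : countType) (f : E -> nat) :
  computable f -> computable (fun e => (f e)./2).
Proof. exact: (computable_nat1 recursive1_half). Qed.

Lemma computable_odd (E : countType) (f : E -> nat) :
  computable f -> computable (fun e => odd (f e)).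
Proof.
move=> cf; apply: (computable_comp (g := odd)) => //.
by exists (fun n => odd n : nat) => //; apply: recursive1_odd.
Qed.

Lemma computable_pred (E : countType) (f : E -> nat) :
  computable f -> computable (fun e => (f e).-1).
Proof.
apply: computable_nat1; apply: (@recursive1_primrec 0 (fun n _ => n)) => //.
exact: recursive_proj.
Qed.

Lemma computable_add (E : countType) (f g : E -> nat) :
  computable f -> computable g -> computable (fun e => f e + g e).
Proof. exact: (computable_nat2 recursive2_add). Qed.

Lemma computable_double (E : countType) (f : E -> nat) :
  computable f -> computable (fun e => (f e).*2).
Proof. exact: (computable_nat1 recursive1_double). Qed.

Lemma computable_mul (E : countType) (f g : E -> nat) :
  computable f -> computable g -> computable (fun e => f e * g e).
Proof.
apply: computable_nat2.
apply: (@recursive2_primrec (fun=> 0) (fun _ c e => e + c)) => //.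
  exact: recursive_const.
by apply: (recursive2_comp recursive2_add); apply: recursive_proj.
Qed.

Lemma computable_eq0 (E : countType) (f : E -> nat) :
  computable f -> computable (fun e => f e == 0).
Proof.
move=> cf; apply: (computable_comp (g := fun n => n == 0)) => //.
by exists (fun n => (n == 0) : nat) => //; apply: recursive1_eq0.
Qed.

Lemma computable_leq (E : countType) (f g : E -> nat) :
  computable f -> computable g -> computable (fun e => f e <= g e).
Proof.
move=> cf cg; apply: computable_eq0.
apply: (@eq_computable _ _ (fun e => iter (g e) predn (f e))).
  move=> e; rewrite -[LHS]/(iter _ _ _).
  by elim: (g e) => /= [|n ->]; rewrite ?subn0 ?subnS.
apply: (computable_iter (g := fun _ => predn)) => //.
by cbv beta; apply: computable_pred; computable_step.
Qed.

Lemma computable_and (E : countType) (f g : E -> bool) :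
  computable f -> computable g -> computable (fun e => f e && g e).
Proof.
by move=> cf cg; apply: computable_if => //; apply: computable_const.
Qed.

Lemma computable_or (E : countType) (f g : E -> bool) :
  computable f -> computable g -> computable (fun e => f e || g e).
Proof.
by move=> cf cg; apply: computable_if => //; apply: computable_const.
Qed.

Lemma computable_eqn (E : countType) (f g : E -> nat) :
  computable f -> computable g -> computable (fun e => f e == g e).
Proof.
move=> cf cg; apply: (@eq_computable _ _
  (fun e => (f e <= g e) && (g e <= f e))).
  by move=> e; rewrite eqn_leq.
by apply: computable_and; apply: computable_leq.
Qed.

Lemma computable_eq (E T : countType) (f g : E -> T) :
  computable f -> computable g -> computable (fun e => f e == g e).
Proof.
move=> [F rF FE] [G rG GE].
apply: (@eq_computable _ _ (fun e => pickle (f e) == pickle (g e))).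
  by move=> e; apply: (inj_eq (pcan_inj pickleK)).
by apply: computable_eqn; [exists F | exists G].
Qed.

Lemma computable_Posz (E : countType) (f : E -> nat) :
  computable f -> computable (fun e => Posz (f e)).
Proof.
move=> cf; apply: (computable_comp (g := Posz)) => //.
exists (fun n => code_cons (code_cons n 0) (code_cons 0 0)) => //.
apply: (recursive2_comp recursive2_cons); last exact: recursive_const.
apply: (recursive2_comp recursive2_cons); first exact: recursive_proj.
exact: recursive_const.
Qed.

Lemma computable_Negz (E : countType) (f : E -> nat) :
  computable f -> computable (fun e => Negz (f e)).
Proof.
move=> cf; apply: (computable_comp (g := Negz)) => //.
exists (fun n => code_cons 0 (code_cons (code_cons n 0) 0)) => //.
apply: (recursive2_comp recursive2_cons); first exact: recursive_const.
apply: (recursive2_comp recursive2_cons); last exact: recursive_const.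
apply: (recursive2_comp recursive2_cons); first exact: recursive_proj.
exact: recursive_const.
Qed.

Lemma computable_int_case (E A : countType) (z : E -> int)
    (f g : E -> nat -> A) :
  computable z ->
  computable (fun u : E * nat => f u.1 u.2) ->
  computable (fun u : E * nat => g u.1 u.2) ->
  computable (fun e => match z e with Posz n => f e n | Negz n => g e n end).
Proof.
move=> cz cf cg.
pose b y := if y is Posz _ then false else true.
pose a y := match y with Posz n => n | Negz n => n end.
have cb : computable b.
  exists (fun c => code_head c == 0); last first.
    by case=> n; rewrite ?pickle_Posz ?pickle_Negz code_consK1 ?code_cons_neq0.
  exact: (recursive1_comp recursive1_eq0 recursive1_head).
have ca : computable a.
  exists (fun c => if code_head c == 0 then code_head (code_head (code_tail c))
                   else code_head (code_head c)); last first.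
    case=> n; rewrite ?pickle_Posz ?pickle_Negz !(code_consK1, code_consK2) //.
    by rewrite code_cons_neq0.
  have rh := recursive1_head; apply: recursive_if.
  - exact: (recursive1_comp recursive1_eq0 rh).
  - exact: (recursive1_comp rh (recursive1_comp rh recursive1_tail)).
  - exact: (recursive1_comp rh rh).
apply: (@eq_computable _ _
  (fun e => if b (z e) then g e (a (z e)) else f e (a (z e)))).
  by move=> e; case: (z e).
have caz : computable (fun e => (e, a (z e))).
  apply: computable_pair; first exact: computable_id.
  exact: computable_comp ca cz.
apply: computable_if; first exact: computable_comp cb cz.
  exact: (computable_comp cg caz).
exact: (computable_comp cf caz).
Qed.

Ltac computable_step ::=
  cbv beta; lazymatch goal with
  | H : computable ?f |- computable ?f => exact: H
  | |- computable (fun e => e) => apply: computable_id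
  | |- computable fst => exact: (computable_fst (computable_id _))
  | |- computable snd => exact: (computable_snd (computable_id _))
  | |- computable (fun _ => ?a) => apply: computable_const
  | |- computable (fun e => (@?f e, @?g e)) =>
      refine (@computable_pair _ _ _ f g _ _)
  | |- computable (fun e => (@?f e).1) => refine (@computable_fst _ _ _ f _)
  | |- computable (fun e => (@?f e).2) => refine (@computable_snd _ _ _ f _)
  | |- computable (fun e => @?f e :: @?g e) =>
      refine (@computable_cons _ _ f g _ _)
  | |- computable
         (fun e => match @?b e with true => @?f e | false => @?g e end) =>
      refine (@computable_if _ _ b f g _ _ _)
  | |- computable (fun e => (@?f e).+1) => refine (@computable_succ _ f _)
  | |- computable (fun e => (@?f e).-1) => refine (@computable_pred _ f _)
  | |- computable (fun e => (@?f e)./2) => refine (@computable_half _ f _)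
  | |- computable (fun e => (@?f e).*2) => refine (@computable_double _ f _)
  | |- computable (fun e => odd (@?f e)) => refine (@computable_odd _ f _)
  | |- computable (fun e => @?f e + @?g e) =>
      refine (@computable_add _ f g _ _)
  | |- computable (fun e => @?f e * @?g e) =>
      refine (@computable_mul _ f g _ _)
  | |- computable (fun e => @?f e <= @?g e) =>
      refine (@computable_leq _ f g _ _)
  | |- computable (fun e => @eq_op _ (@?f e) (@?g e)) =>
      refine (@computable_eq _ _ f g _ _)
  | |- computable (fun e => @?f e && @?g e) =>
      refine (@computable_and _ f g _ _)
  | |- computable (fun e => @?f e || @?g e) =>
      refine (@computable_or _ f g _ _)
  | |- computable (fun e => Posz (@?f e)) => refine (@computable_Posz _ f _)
  | |- computable (fun e => Negz (@?f e)) => refine (@computable_Negz _ f _)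
  | |- computable (fun e => foldl (@?g e) (@?f e) (@?s e)) =>
      refine (@computable_foldl _ _ _ f s g _ _ _)
  | |- computable (fun e => iter (@?n e) (@?g e) (@?f e)) =>
      refine (@computable_iter _ _ n f g _ _ _)
  | H : computable ?f |- computable (fun e => ?f (@?g e)) =>
      refine (@computable_comp _ _ _ f g H _)
  end.

Ltac computable_tac := repeat computable_step.

Lemma computable_rev (E T : countType) (f : E -> seq T) :
  computable f -> computable (fun e => rev (f e)).
Proof.
move=> cf; apply: (@eq_computable _ _
  (fun e => foldl (fun s x => x :: s) [::] (f e))).
  move=> e; rewrite -[RHS]cats0 -[rev _ ++ _]catrevE.
  by elim: (f e) [::] => //= x s IHs t; rewrite IHs.
by computable_tac.
Qed.

Lemma computable_cat (E T : countType) (f g : E -> seq T) :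
  computable f -> computable g -> computable (fun e => f e ++ g e).
Proof.
move=> cf cg; have cr := computable_rev cf.
apply: (@eq_computable _ _
  (fun e => foldl (fun s x => x :: s) (g e) (rev (f e)))).
  move=> e; rewrite foldl_rev; elim: (f e) => //= x s -> //.
by computable_tac.
Qed.

Lemma computable_map (E T U : countType) (f : E -> T -> U) (s : E -> seq T) :
  computable (fun u : E * T => f u.1 u.2) -> computable s ->
  computable (fun e => map (f e) (s e)).
Proof.
move=> cf cs.
apply: (@eq_computable _ _
  (fun e => rev (foldl (fun l x => f e x :: l) [::] (s e)))).
  move=> e; rewrite -[RHS]revK; congr rev; rewrite -map_rev -[RHS]cats0.
  elim: (s e) [::] => //= x l IHl t.
  by rewrite rev_cons map_rcons cat_rcons IHl.
apply: computable_rev; computable_tac.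
apply: (computable_comp (f := fun u : E * seq U * T => (u.1.1, u.2)) cf).
by computable_tac.
Qed.

Lemma computable_flatten (E T : countType) (s : E -> seq (seq T)) :
  computable s -> computable (fun e => flatten (s e)).
Proof.
move=> cs; apply: (@eq_computable _ _ (fun e => foldl cat [::] (s e))).
  move=> e; rewrite -[RHS]cat0s.
  elim: (s e) [::] => [|x l IHl] t /=; first by rewrite cats0.
  by rewrite IHl catA.
computable_tac; apply: computable_cat; computable_tac.
Qed.

Lemma computable_filter (E T : countType) (p : E -> T -> bool)
    (s : E -> seq T) :
  computable (fun u : E * T => p u.1 u.2) -> computable s ->
  computable (fun e => filter (p e) (s e)).
Proof.
move=> cp cs.
apply: (@eq_computable _ _
  (fun e => flatten [seq if p e x then [:: x] else [::] | x <- s e])).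
  by move=> e; elim: (s e) => //= x l ->; case: (p e x).
apply: computable_flatten; apply: computable_map => //; computable_tac.
Qed.

Lemma computable_all (E T : countType) (p : E -> T -> bool) (s : E -> seq T) :
  computable (fun u : E * T => p u.1 u.2) -> computable s ->
  computable (fun e => all (p e) (s e)).
Proof.
move=> cp cs; apply: (@eq_computable _ _
  (fun e => foldl (fun b x => b && p e x) true (s e))).
  move=> e; rewrite -[RHS]andTb.
  elim: (s e) true => [|x l IHl] b /=; first by rewrite andbT.
  by rewrite IHl andbA.
computable_tac.
apply: (computable_comp (f := fun u : E * bool * T => (u.1.1, u.2)) cp).
by computable_tac.
Qed.

Lemma computable_size (E T : countType) (s : E -> seq T) :
  computable s -> computable (fun e => size (s e)).
Proof.
move=> cs; apply: (@eq_computable _ _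
  (fun e => foldl (fun n _ => n.+1) 0 (s e))).
  move=> e; rewrite -[RHS]add0n.
  elim: (s e) 0 => [|x l IHl] n /=; first by rewrite addn0.
  by rewrite IHl addSnnS.
by computable_tac.
Qed.

Lemma computable_nth (E T : countType) (x : T) (s : seq T) (f : E -> nat) :
  computable f -> computable (fun e => nth x s (f e)).
Proof.
move=> cf.
apply: (@eq_computable _ _
  (fun e => if iter (f e) behead s is y :: _ then y else x)).
  by move=> e; elim: (f e) s {cf} => [|n IHn] [|y s] //;
    rewrite iterSr IHn ?nth_nil.
apply: computable_list_case; computable_tac.
apply: (@eq_computable _ _
  (fun u : E * seq T => if u.2 is _ :: s' then s' else [::])).
  by case=> e [].
by apply: computable_list_case; computable_tac.
Qed.

(** * Words in numbered letters *)

(** Below, a word is the list of the codes of its letters: [2 * i] is the i-th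
    generator and [2 * i + 1] its inverse. *)
Definition letter_codes (I : Type) (idx : I -> nat) (w : word I) : seq nat :=
  [seq (idx l.1).*2 + l.2 | l : I * bool <- w].

Definition value (G : groupType) (x : nat -> G) (cs : seq nat) : G :=
  word_eval x [seq (c./2, odd c) | c <- cs].

(** A family indexed by all numbers covers finite and infinite generating sets
    at once: a finite family is extended by ones. *)
Definition decidable_on (G : groupType) (x : nat -> G) (P : G -> Prop) : Prop :=
  exists2 chi : seq nat -> bool, computable chi &
    forall cs, P (value x cs) <-> chi cs.

Lemma pickle_seq_nat (cs : seq nat) : pickle cs = CodeSeq.code cs.
Proof. by rewrite -[cs in RHS]map_id. Qed.

Lemma recursive_languageP (I : Type) (idx : I -> nat) (L : word I -> Prop) :
  recursive_language idx L <->
  exists2 chi : seq nat -> bool, computable chi &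
    forall w, L w <-> chi (letter_codes idx w).
Proof.
split=> [[chi rchi Lchi]|[chi [F rF FE] Lchi]].
  exists (fun cs => chi (CodeSeq.code cs)) => //.
  by exists (fun n => chi n : nat) => // cs; rewrite pickle_seq_nat.
exists (fun n => ~~ (F n == 0)).
  apply: (@eq_recursive _ (fun t : 1.-tuple nat =>
      if F (thead t) == 0 then 0 else 1)).
    by move=> t; case: eqP.
  apply: recursive_if; [|exact: recursive_const..].
  exact: (recursive1_comp recursive1_eq0 rF).
move=> w; rewrite Lchi.
have -> : word_code idx w = pickle (letter_codes idx w).
  by rewrite pickle_seq_nat.
by rewrite FE; case: (chi _).
Qed.

Lemma letter_codeK i (b : bool) :
  ((i.*2 + b)./2 = i) * (odd (i.*2 + b) = b).
Proof. by rewrite addnC half_bit_double oddD odd_double addbF oddb. Qed.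

Section Value.
Variables (G : groupType).
Implicit Types (x y : nat -> G) (cs : seq nat).
Local Open Scope group_scope.

Lemma value_nil x : value x [::] = 1.
Proof. exact: big_nil. Qed.

Lemma value_cons x c cs :
  value x (c :: cs) = (if odd c then (x c./2)^-1 else x c./2) * value x cs.
Proof. exact: big_cons. Qed.

Lemma value_cat x cs ds : value x (cs ++ ds) = value x cs * value x ds.
Proof. by rewrite /value /word_eval map_cat big_cat. Qed.

Lemma value1 x i : value x [:: i.*2] = x i.
Proof. by rewrite value_cons value_nil mulg1 odd_double doubleK. Qed.

Lemma eq_value x y cs : x =1 y -> value x cs = value y cs.
Proof.
by move=> xy; rewrite /value /word_eval; apply: eq_bigr => l _; rewrite xy.
Qed.

Definition inverse_codes cs :=
  rev [seq if odd c then c.-1 else c.+1 | c <- cs].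

Lemma value_inverse x cs : value x (inverse_codes cs) = (value x cs)^-1.
Proof.
elim: cs => [|c cs IHcs]; first by rewrite value_nil invg1.
rewrite /inverse_codes /= rev_cons -cats1 value_cat -/(inverse_codes cs) IHcs.
rewrite !value_cons value_nil mulg1 invgM; congr (_ * _).
case: (boolP (odd c)) => oc.
  case: c oc => //= c oc; rewrite (negbTE oc) invgK; congr x.
  by rewrite uphalf_half (negbTE oc).
by rewrite /= oc uphalf_half (negbTE oc).
Qed.

(** The letter i is replaced by the word [th i]. *)
Definition substitute (th : nat -> seq nat) cs :=
  flatten [seq if odd c then inverse_codes (th c./2) else th c./2 | c <- cs].

Lemma value_substitute x th cs :
  value x (substitute th cs) = value (fun i => value x (th i)) cs.
Proof.
elim: cs => [|c cs IHcs]; first by rewrite !value_nil.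
rewrite value_cons -IHcs /substitute /= value_cat.
by case: ifP; rewrite ?value_inverse.
Qed.

Lemma computable_substitute th : computable th -> computable (substitute th).
Proof.
move=> cth; apply: computable_flatten.
apply: (computable_map (f := fun=> _)); computable_tac.
apply: computable_rev; apply: (computable_map (f := fun=> _)); computable_tac.
Qed.

(** All changes of generators are instances of this many-one reduction. *)
Lemma decidable_on_substitute x y th (P : G -> Prop) :
  computable th -> (forall i, y i = value x (th i)) ->
  decidable_on x P -> decidable_on y P.
Proof.
move=> cth yE [chi cchi Pchi]; exists (fun cs => chi (substitute th cs)).
  exact: (computable_comp cchi (computable_substitute cth)).
by move=> cs; rewrite -Pchi value_substitute (eq_value _ yE).
Qed.

Definition extend n (s : 'I_n -> G) (i : nat) : G := oapp s 1 (insub i).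

Lemma extend_ord n (s : 'I_n -> G) (i : 'I_n) : extend s i = s i.
Proof. by rewrite /extend valK. Qed.

Lemma value_extend n (s : 'I_n -> G) (w : word 'I_n) :
  value (extend s) (letter_codes (@nat_of_ord n) w) = word_eval s w.
Proof.
elim: w => [|[i b] w IHw]; first by rewrite value_nil /word_eval big_nil.
by rewrite value_cons IHw /word_eval [RHS]big_cons /= !letter_codeK extend_ord.
Qed.

Lemma extend_word n (s : 'I_n -> G) cs :
  exists2 w : word 'I_n,
    letter_codes (@nat_of_ord n) w = [seq c <- cs | c./2.+1 <= n] &
    word_eval s w = value (extend s) cs.
Proof.
elim: cs => [|c cs [w wE ws]].
  by exists [::]; rewrite // value_nil /word_eval big_nil.
rewrite value_cons -ws /extend /=.
case: insubP => [i ci iE|/negbTE->] /=; last first.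
  by exists w => //; rewrite invg1; case: ifP; rewrite mul1g.
exists ((i, odd c) :: w); last by rewrite /word_eval big_cons.
by rewrite /= ci wE iE addnC odd_double_half.
Qed.

(** Letters out of range evaluate to one, so they may be erased before the
    given decision procedure is called. *)
Lemma decidable_on_extend n (s : 'I_n -> G) (P : G -> Prop) :
  recursive_language (@nat_of_ord n) (fun w => P (word_eval s w)) ->
  decidable_on (extend s) P.
Proof.
move=> /recursive_languageP [chi cchi Pchi].
exists (fun cs => chi [seq c <- cs | c./2.+1 <= n]); last first.
  by move=> cs; have [w <- <-] := extend_word s cs.
apply: (computable_comp cchi).
by apply: (computable_filter (p := fun=> _)); computable_tac.
Qed.

Lemma letter_codesK (w : word nat) :
  [seq (c./2, odd c) | c <- letter_codes id w] = w.
Proof.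
by elim: w => //= -[i b] w ->; rewrite !letter_codeK.
Qed.

Lemma recursive_language_decidable_on x (P : G -> Prop) :
  recursive_language id (fun w => P (word_eval x w)) <-> decidable_on x P.
Proof.
rewrite recursive_languageP; split=> -[chi cchi Pchi].
  exists chi => // cs; rewrite Pchi.
  suff -> : letter_codes id [seq (c./2, odd c) | c <- cs] = cs by [].
  by elim: cs => //= c cs ->; rewrite addnC odd_double_half.
by exists chi => // w; rewrite -Pchi /value letter_codesK.
Qed.

End Value.

Lemma multiplicative1 (H G : groupType) (phi : {multiplicative H -> G}) :
  phi 1%g = 1%g.
Proof. by apply: (@mulgI _ (phi 1%g)); rewrite -gmulfM !mulg1. Qed.

Lemma multiplicativeV (H G : groupType) (phi : {multiplicative H -> G}) h :
  phi h^-1%g = (phi h)^-1%g.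
Proof.
by apply: (@mulgI _ (phi h)); rewrite -gmulfM !mulgV multiplicative1.
Qed.

Lemma value_morph (H G : groupType) (phi : {multiplicative H -> G})
    (x : nat -> H) cs : phi (value x cs) = value (fun i => phi (x i)) cs.
Proof.
elim: cs => [|c cs IHcs]; first by rewrite !value_nil multiplicative1.
by rewrite !value_cons gmulfM IHcs; case: ifP; rewrite ?multiplicativeV.
Qed.

(** The subgroup is generated by the words of the overgroup that lie in it.
    They can be listed, because every number is the code of a word and
    membership is decidable; a word outside the subgroup is replaced by the
    empty word. A word in these generators is a word of the overgroup after
    substitution, and triviality is the same in both groups. *)
Lemma computable_group_of_overgroup (H G : groupType) (K : {pred G}) :
  isomorphic_to_subgroup H K -> decidable_word_problem G ->
  decidable_membership K -> computable_group H.
Proof.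
move=> [_ [phi [phi_inj phiK]]] [n [s [gens dG]]] [m [r [genr dK]]].
have {}dG := decidable_on_extend (P := fun g => g = 1%g) dG.
have {}dK := decidable_on_extend (P := fun g => g \in K) dK.
(* The two problems may refer to different generators: the table rewrites those
   of the word problem in those of the membership problem. *)
have [tbl tblE] : exists tbl : seq (seq nat), forall i,
    extend s i = value (extend r) (nth [::] tbl i).
  have [f fE] := fin_all_exists (fun i => genr (s i)).
  exists [seq letter_codes (@nat_of_ord m) (f i) | i <- enum 'I_n] => i.
  case: (ltnP i n) => [ltin|lein]; last first.
    rewrite nth_default; last by rewrite size_map size_enum_ord.
    by rewrite value_nil /extend insubN // -leqNgt.
  rewrite (nth_map (Ordinal ltin)) ?size_enum_ord // value_extend fE.
  rewrite -[i in LHS]/(nat_of_ord (Ordinal ltin)) extend_ord.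
  by rewrite (nth_ord_enum _ (Ordinal ltin)).
have {}dK : decidable_on (extend s) (fun g => g \in K).
  apply: (decidable_on_substitute _ tblE dK).
  by apply: computable_nth; computable_tac.
have [chi cchi Kchi] := dK.
have cdec : computable CodeSeq.decode.
  exists id; first exact: recursive_proj.
  by move=> c; rewrite pickle_seq_nat CodeSeq.decodeK.
pose th i := if chi (CodeSeq.decode i) then CodeSeq.decode i else [::].
have thK i : value (extend s) (th i) \in K.
  rewrite /th; case: ifP => [/Kchi//|_]; rewrite value_nil.
  by apply/phiK; exists 1%g; rewrite multiplicative1.
have [|x xE] := @boolp.choice _ _
    (fun i h => phi h = value (extend s) (th i)).
  by move=> i; apply/phiK.
right; exists x; split.
  move=> h; have [w wE] := gens (phi h).
  pose cs := letter_codes (@nat_of_ord n) w.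
  have csE : value (extend s) cs = phi h by rewrite value_extend.
  exists [:: (CodeSeq.code cs, false)].
  rewrite /word_eval big_cons big_nil mulg1.
  apply: phi_inj; rewrite xE /th CodeSeq.codeK -csE.
  have -> // : chi cs.
  by apply/Kchi; rewrite csE; apply/phiK; exists h.
apply/(recursive_language_decidable_on _ (fun h => h = 1%g)).
have [|chi' cchi' E'] :=
    decidable_on_substitute (y := fun i => phi (x i)) _ xE dG.
  by rewrite /th; computable_tac.
exists chi' => // cs; rewrite -E' -value_morph.
split=> [->|]; first exact: multiplicative1.
by rewrite -[1%g in X in X -> _](multiplicative1 phi) => /phi_inj.
Qed.

(** Prefixing the generators with 1 costs nothing, and gives a harmless label
    to the generator of the overgroup that only moves the second coordinate. *)
Lemma computable_group_pointed_sequence (H : groupType) :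
  computable_group H ->
  exists y : nat -> H, [/\ y 0 = 1%g, forall h, exists cs, value y cs = h
    & decidable_on y (fun h => h = 1%g)].
Proof.
suff key (x : nat -> H) : (forall h, exists cs, value x cs = h) ->
    decidable_on x (fun h => h = 1%g) ->
  exists y : nat -> H, [/\ y 0 = 1%g, forall h, exists cs, value y cs = h
    & decidable_on y (fun h => h = 1%g)].
  case=> [[n [s [gens dH]]]|[x [genx dH]]].
    apply: (key (extend s)); last first.
      exact: (decidable_on_extend (P := fun h => h = 1%g)).
    move=> h; have [w wE] := gens h.
    by exists (letter_codes (@nat_of_ord n) w); rewrite value_extend.
  apply: (key x); last first.
    exact/(recursive_language_decidable_on x (fun h => h = 1%g)).
  move=> h; have [w wE] := genx h.
  by exists (letter_codes id w); rewrite /value letter_codesK.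
move=> genx dx; exists (fun i => if i is j.+1 then x j else 1%g); split=> //.
  move=> h; have [cs <-] := genx h; exists [seq c.+2 | c <- cs].
  by elim: cs => [|c cs IHcs]; rewrite ?value_nil //= !value_cons IHcs /= negbK.
pose th i := if i == 0 then [::] else [:: i.-1.*2].
apply: (decidable_on_substitute (th := th) _ _ dx) => [|[|i]].
- by rewrite /th; computable_tac.
- by rewrite value_nil.
- by rewrite value1.
Qed.

(** * The subgroup generated by a finite family *)

Section Generated.
Variables (W : groupType) (n : nat) (s : 'I_n -> W).
Local Open Scope group_scope.

Definition generated : {pred W} :=
  fun g => boolp.asbool (exists cs, value (extend s) cs = g).

Lemma generatedP g :
  reflect (exists cs, value (extend s) cs = g) (g \in generated).
Proof. exact: boolp.asboolP. Qed.

Definition generated_group := {g : W | g \in generated}.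

HB.instance Definition _ := SubChoice.on generated_group.

Lemma generated_closed : group_closed generated.
Proof.
split; first by apply/generatedP; exists [::]; apply: value_nil.
move=> _ _ /generatedP[cs <-] /generatedP[ds <-]; apply/generatedP.
by exists (cs ++ inverse_codes ds); rewrite value_cat value_inverse.
Qed.

HB.instance Definition _ :=
  SubChoice_isSubGroup.Build W generated generated_group generated_closed.

Lemma generated_subgroup :
  exists (G : groupType) (iota : {multiplicative G -> W}) (r : 'I_n -> G),
    [/\ injective iota, generates r & forall i, iota (r i) = s i].
Proof.
have sin i : s i \in generated.
  by apply/generatedP; exists [:: (nat_of_ord i).*2]; rewrite value1 extend_ord.
pose r i : generated_group := Sub (s i) (sin i).
have rE i : val (r i) = s i by exact: SubK.
pose iota : {multiplicative generated_group -> W} := \val.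
exists generated_group, iota, r; split=> //; first exact: val_inj.
move=> g; have /generatedP[cs csE] := valP g.
have [w _ wE] := extend_word r cs; exists w; rewrite wE; apply: val_inj.
rewrite -csE; transitivity (iota (value (extend r) cs)) => //.
rewrite value_morph; apply: eq_value => i; rewrite /extend.
by case: insubP => //= *; apply: val1.
Qed.

End Generated.

(** * The twice iterated wreath product with the integers *)

Section Wreath.
Variable H : groupType.

(** The element acts on triples (p, q, h) on the right by
    (p + shift, q + turn p, h * fibre p q). This is the unrestricted wreath
    product of H with the integers, and then of the result with the integers. *)
Record wreath := Wreath {
  shift : int; turn : int -> int; fibre : int -> int -> H }.

HB.instance Definition _ := boolp.gen_eqMixin wreath.
HB.instance Definition _ := boolp.gen_choiceMixin wreath.

Local Open Scope group_scope.
Local Open Scope ring_scope.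

Lemma wreath_eq g h : shift g = shift h -> turn g =1 turn h ->
  fibre g =2 fibre h -> g = h.
Proof.
case: g h => s t f [s' t' f'] /= -> /boolp.funext -> ff'; congr Wreath.
by apply: boolp.funext => p; apply: boolp.funext => q.
Qed.

Definition wreath_one := Wreath 0 (fun=> 0) (fun _ _ => 1%g).

(** Composition of the actions, the left factor acting first. *)
Definition wreath_mul g h := Wreath (shift g + shift h)
  (fun p => turn g p + turn h (p + shift g))
  (fun p q => fibre g p q * fibre h (p + shift g)%R (q + turn g p)%R)%g.

Definition wreath_inv g := Wreath (- shift g)
  (fun p => - turn g (p - shift g))
  (fun p q => (fibre g (p - shift g)%R (q - turn g (p - shift g))%R)^-1)%g.

Lemma wreath_mulA : associative wreath_mul.
Proof.
move=> f g h; apply: wreath_eq => [|p|p q] /=; rewrite ?GRing.addrA //.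
by rewrite mulgA.
Qed.

Lemma wreath_mul1 : left_id wreath_one wreath_mul.
Proof.
move=> g; apply: wreath_eq => [|p|p q] /=; rewrite ?GRing.add0r ?GRing.addr0 //.
by rewrite mul1g.
Qed.

Lemma wreath_mulr1 : right_id wreath_one wreath_mul.
Proof.
move=> g; apply: wreath_eq => [|p|p q] /=; rewrite ?GRing.addr0 //.
by rewrite mulg1.
Qed.

Lemma wreath_mulV : left_inverse wreath_one wreath_inv wreath_mul.
Proof.
move=> g; apply: wreath_eq => [|p|p q] /=; rewrite ?GRing.addNr //.
by rewrite mulVg.
Qed.

Lemma wreath_mulrV : right_inverse wreath_one wreath_inv wreath_mul.
Proof.
move=> g; apply: wreath_eq => [|p|p q] /=;
  rewrite ?GRing.addrN ?GRing.addrK ?GRing.addrN //.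
by rewrite mulgV.
Qed.

HB.instance Definition _ := isGroup.Build wreath
  wreath_mulA wreath_mul1 wreath_mulr1 wreath_mulV wreath_mulrV.

(** The copy of H that acts at the single position (0, 0). *)
Definition point_mass (h : H) : wreath := Wreath 0 (fun=> 0)
  (fun p q => if (p == 0) && (q == 0) then h else 1%g).

Lemma point_massM : {morph point_mass : g h / (g * h)%g}.
Proof.
move=> g h; apply: wreath_eq => [|p|p q] //=; rewrite !GRing.addr0.
by case: ifP; rewrite ?mulg1.
Qed.

HB.instance Definition _ :=
  isMultiplicative.Build H wreath point_mass point_massM.

Lemma point_mass_inj : injective point_mass.
Proof. by move=> g h /(congr1 (fun w => fibre w 0 0)). Qed.

End Wreath.

(** * Three generators *)

(** The integer square root, as an iteration, the form in which its
    computability is immediate. *)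
Definition isqrt n := iter n (fun r => if r.+1 * r.+1 <= n then r.+1 else r) 0.

Lemma isqrt_square j : isqrt (j * j) = j.
Proof.
rewrite /isqrt; set f := fun r => _.
have lej k : iter k f 0 = minn k j.
  elim: k => [|k IHk]; first by rewrite min0n.
  rewrite iterS IHk /f.
  case: (ltnP k j) => kj.
    by rewrite leq_mul //; lia.
  by rewrite ifF; [lia | apply/negbTE; rewrite -ltnNge; nia].
by rewrite lej; case: j {lej f} => // j; nia.
Qed.

Definition label (p : int) : nat := if p is Posz n then isqrt n else 0.

(** The generator 1 acts at position 0 only, the generator 2 at the squares; the
    generator 0 moves positions, and acts on no second coordinate. *)
Definition hit (i : nat) (p : int) : bool :=
  if p is Posz n then
    if i == 1 then n == 0 else if i == 2 then isqrt n * isqrt n == n else false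
  else false.

Lemma label_square j : label (Posz (j * j)) = j.
Proof. exact: isqrt_square. Qed.

Lemma hit0 p : hit 0 p = false. Proof. by case: p. Qed.

Lemma hit1E p : hit 1 p = (p == 0%R). Proof. by case: p => [[]|]. Qed.

Lemma hit2P p : reflect (exists j, p = Posz (j * j)) (hit 2 p).
Proof.
apply: (iffP idP) => [|[j ->]]; last by rewrite /hit /= isqrt_square.
by case: p => // n /eqP nE; exists (isqrt n); rewrite nE.
Qed.

Lemma hitE i p : hit i p = [|| (i == 1) && hit 1 p | (i == 2) && hit 2 p].
Proof. by case: p => // n; case: i => [|[|[|i]]] //=; rewrite orbF. Qed.

Section Generators.
Variables (H : groupType) (y : nat -> H).
Hypothesis y0 : y 0 = 1%g.
Local Open Scope ring_scope.

(** Given by cases, so that it is computable by case analysis on integers. *)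
Definition nonneg (q : int) : bool := if q is Posz _ then true else false.

Lemma nonnegE q : nonneg q = (0 <= q). Proof. by case: q. Qed.

(** The generator 0 shifts p. The other two shift q by one at the positions that
    they hit, and moreover multiply by [y (label p)] where q is nonnegative.
    At a square position the generator 2 has infinite order whatever the order
    of [y] is; at position 0 the label is 0, and [y 0] = 1 makes the generator 1
    a pure shift of q. *)
Definition gen (i : nat) : wreath H :=
  if i == 0%N then Wreath 1 (fun=> 0) (fun _ _ => 1%g) else
  Wreath 0 (fun p => if hit i p then 1 else 0)
    (fun p q => if hit i p && nonneg q then y (label p) else 1%g).

Lemma shiftM (g h : wreath H) : shift (g * h)%g = shift g + shift h.
Proof. by []. Qed.

Lemma turnM (g h : wreath H) p :
  turn (g * h)%g p = turn g p + turn h (p + shift g).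
Proof. by []. Qed.

Lemma fibreM (g h : wreath H) p q :
  fibre (g * h)%g p q =
  (fibre g p q * fibre h (p + shift g)%R (q + turn g p)%R)%g.
Proof. by []. Qed.

Lemma shiftV (g : wreath H) : shift g^-1%g = - shift g.
Proof. by []. Qed.

Lemma turnV (g : wreath H) p : turn g^-1%g p = - turn g (p - shift g).
Proof. by []. Qed.

Lemma fibreV (g : wreath H) p q :
  fibre g^-1%g p q =
  (fibre g (p - shift g)%R (q - turn g (p - shift g))%R)^-1%g.
Proof. by []. Qed.

Definition wreathE :=
  (shiftM, turnM, fibreM, shiftV, turnV, fibreV).

Lemma translation k :
  exists cs, value gen cs = Wreath (Posz k) (fun=> 0) (fun _ _ => 1%g).
Proof.
elim: k => [|k [cs csE]]; first by exists [::]; rewrite value_nil.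
exists (0%N :: cs); rewrite value_cons csE; apply: wreath_eq => [|p|p q] //.
by rewrite wreathE mulg1.
Qed.

(** Let t be the generator 1 and u the generator 2 conjugated so that the square
    [j * j] comes to position 0. Away from position 0, t acts trivially, and so
    does the commutator u t^-1 u^-1 t. At position 0, u is the product of the
    step function that is [y j] on nonnegative q with the shift of q, and t is
    that shift alone: the commutator is the quotient of the step function by
    its translate, which is [y j] at q = 0 and trivial elsewhere. *)
Lemma point_mass_gen j : exists cs, value gen cs = point_mass (y j).
Proof.
have [cs csE] := translation (j * j).
pose u := (value gen cs * gen 2 * (value gen cs)^-1)%g.
have [ds dsE] : exists ds, value gen ds = u.
  exists (cs ++ [:: 4%N] ++ inverse_codes cs).
  by rewrite !value_cat value_inverse value_cons value_nil mulg1 mulgA.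
have sS : shift (value gen cs) = Posz (j * j) by rewrite csE.
have tS p : turn (value gen cs) p = 0 by rewrite csE.
have fS p q : fibre (value gen cs) p q = 1%g by rewrite csE.
have h2 : hit 2 (Posz (j * j)) by apply/hit2P; exists j.
have sb : shift (gen 2) = 0 by [].
have tb p : turn (gen 2) p = if hit 2 p then 1 else 0 by [].
have fb p q : fibre (gen 2) p q =
  if hit 2 p && nonneg q then y (label p) else 1%g by [].
have su : shift u = 0 by rewrite !(wreathE, sS, sb); lia.
have tu : turn u 0 = 1 by rewrite !(wreathE, sS, tS, sb, tb) GRing.add0r h2.
have fu q : fibre u 0 q = if nonneg q then y j else 1%g.
  rewrite !(wreathE, sS, tS, fS, fb) GRing.add0r GRing.addr0 h2 /=.
  by rewrite isqrt_square invg1 mulg1 mul1g.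
clearbody u.
exists (ds ++ [:: 3%N] ++ inverse_codes ds ++ [:: 2%N]).
rewrite !value_cat value_inverse !value_cons value_nil !mulg1 dsE /=.
set t := gen 1.
have st : shift t = 0 by [].
have tt p : turn t p = if p == 0 then 1 else 0 by rewrite /t /gen /= -hit1E.
have ft p q : fibre t p q = 1%g.
  rewrite /t /gen /= hit1E; case: eqP => //= ->; rewrite -[label _]/0%N y0.
  by case: ifP.
clearbody t; apply: wreath_eq => [|p|p q].
- by rewrite !wreathE su st.
- by rewrite !(wreathE, su, st, tt, GRing.addr0, GRing.subr0) [RHS]/=; lia.
rewrite !(wreathE, su, st, tt, ft) !(GRing.addr0, GRing.subr0).
rewrite invg1 mul1g mulg1 /=.
case: (eqVneq p 0) => [->|p0] /=; last first.
  by rewrite !GRing.oppr0 !GRing.addr0 GRing.addrK mulgV.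
rewrite tu GRing.addrK !fu !nonnegE.
case: (eqVneq q 0) => [->|q0] /=; first by rewrite invg1 mulg1.
have -> : (0 <= q - 1) = (0 <= q) by lia.
by rewrite mulgV.
Qed.

(** The generators and their inverses, indexed by the codes of letters. *)
Definition letter_gen (c : nat) : wreath H :=
  if odd c then (gen c./2)^-1%g else gen c./2.

Lemma shift_gen i : shift (gen i) = if i == 0%N then 1 else 0.
Proof. by rewrite /gen; case: ifP. Qed.

Lemma turn_gen i p : turn (gen i) p = if hit i p then 1 else 0.
Proof. by case: i => [|i] //; case: p. Qed.

Lemma fibre_gen i p q :
  fibre (gen i) p q = if hit i p && nonneg q then y (label p) else 1%g.
Proof. by case: i => [|i] //; case: p. Qed.

Lemma shift_letter c : shift (letter_gen c) =
  if c./2 == 0%N then if odd c then -1 else 1 else 0.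
Proof.
by rewrite /letter_gen; case: odd; rewrite ?wreathE shift_gen; case: ifP.
Qed.

Lemma hit_shift i p : hit i (p - shift (gen i)) = hit i p.
Proof. by case: i => [|i]; [rewrite !hit0 | rewrite shift_gen GRing.subr0]. Qed.

Lemma turn_letter c p : turn (letter_gen c) p =
  if hit c./2 p then if odd c then -1 else 1 else 0.
Proof.
rewrite /letter_gen; case: odd; rewrite ?wreathE turn_gen ?hit_shift //.
by case: ifP.
Qed.

Lemma fibre_letter c p q : fibre (letter_gen c) p q =
  if hit c./2 p && nonneg (if odd c then q - 1 else q) then
    if odd c then (y (label p))^-1%g else y (label p)
  else 1%g.
Proof.
rewrite /letter_gen; case: odd; rewrite ?wreathE fibre_gen //.
rewrite turn_gen !hit_shift.
case: (boolP (hit _ p)) => [h|_]; last by rewrite invg1.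
have -> : p - shift (gen c./2) = p.
  by rewrite shift_gen; case: c./2 h => [|i]; rewrite ?hit0 //= GRing.subr0.
by case: ifP; rewrite ?invg1.
Qed.

Lemma value_letter c cs : value gen (c :: cs) = (letter_gen c * value gen cs)%g.
Proof. exact: value_cons. Qed.

Lemma shift_letter_bound c : -1 <= shift (letter_gen c) <= 1.
Proof. by rewrite shift_letter; do 2?case: ifP. Qed.

Lemma turn_letter_bound c p : -1 <= turn (letter_gen c) p <= 1.
Proof. by rewrite turn_letter; do 2?case: ifP. Qed.

(** A word of length n started at p only visits positions at distance at most n
    from p, and its effect on q depends only on which of them are hit. *)
Lemma eq_turn cs p p' :
  (forall k, `|k| <= (size cs)%:Z ->
     forall i, hit i (p + k) = hit i (p' + k)) ->
  turn (value gen cs) p = turn (value gen cs) p'.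
Proof.
elim: cs p p' => [|c cs IHcs] p p' hp; first by rewrite value_nil.
rewrite value_letter !wreathE !turn_letter.
have := hp 0; rewrite !GRing.addr0 => -> //; congr (_ + _).
apply: IHcs => k kcs i; rewrite -!GRing.addrA; apply: hp => /=.
have := shift_letter_bound c; lia.
Qed.

(** Similarly the effect on h depends on q only through the signs of the
    numbers at distance at most n from q. *)
Lemma eq_fibre cs p q q' :
  (forall k, `|k| <= (size cs)%:Z -> (0 <= q + k) = (0 <= q' + k)) ->
  fibre (value gen cs) p q = fibre (value gen cs) p q'.
Proof.
elim: cs p q q' => [|c cs IHcs] p q q' hq; first by rewrite value_nil.
rewrite value_letter !wreathE !fibre_letter; congr (_ * _)%g.
  rewrite !nonnegE; case: odd; first by rewrite (hq (-1)).
  by have := hq 0; rewrite !GRing.addr0 => -> //.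
apply: IHcs => k kcs; rewrite -!GRing.addrA; apply: hq => /=.
have := turn_letter_bound c p; lia.
Qed.

(** A primitive of the step function: translating q by one multiplies it by [h]
    exactly when q is nonnegative. *)
Definition ramp (h : H) (q : int) : H :=
  if q is Posz n then (h ^+ n)%g else 1%g.

Lemma rampS h q : ramp h (q + 1) = (ramp h q * if nonneg q then h else 1)%g.
Proof.
case: q => n.
  by rewrite /= (_ : (n + 1)%N = n.+1) ?addn1 // expgSr.
by case: n => [|n]; rewrite mulg1.
Qed.

(** If a single square is visited, all factors come from the same [y j], and the
    product telescopes. In particular it is trivial as soon as the word brings q
    back to its initial value. *)
Lemma fibre_single cs j p q :
  (forall k, `|k| <= (size cs)%:Z ->
     ~~ hit 1 (p + k) /\ (hit 2 (p + k) -> label (p + k) = j)) ->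
  fibre (value gen cs) p q =
  ((ramp (y j) q)^-1 * ramp (y j) (q + turn (value gen cs) p)%R)%g.
Proof.
elim: cs p q => [|c cs IHcs] p q hp.
  by rewrite value_nil [RHS](_ : _ = 1%g) //= GRing.addr0 mulVg.
rewrite value_letter !wreathE fibre_letter turn_letter IHcs; last first.
  move=> k kcs; rewrite -!GRing.addrA; apply: hp => /=.
  have := shift_letter_bound c; lia.
have := hp 0; rewrite !GRing.addr0 => -[] // /negbTE n1 h2.
rewrite hitE n1 andbF /=.
case: (boolP (hit 2 p)) h2 => [_ /(_ isT) ->|_ _]; last first.
  by rewrite andbF GRing.addr0 GRing.add0r mul1g.
rewrite andbT; case: (_ == 2) => /=; last first.
  by rewrite GRing.addr0 GRing.add0r mul1g.
rewrite !GRing.addrA mulgA; congr (_ * _)%g.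
case: odd; last by rewrite rampS invgM mulVKg.
rewrite -[in RHS](GRing.subrK 1 q) rampS invgM.
by case: nonneg; rewrite ?invg1.
Qed.

(** Positions further than this are governed by closer ones, for words of
    length n: the gaps between the squares from [n.+1 * n.+1] on exceed the
    width 2 n of the window that such a word can visit. *)
Definition near_radius (n : nat) : nat := (n.+1 * n.+1 + n)%N.

Lemma square_window (i j n : nat) k :
  (n < j)%N -> (i * i)%N%:Z = (j * j)%N%:Z + k -> `|k| <= (n.*2)%:Z -> i = j.
Proof.
move=> nj ij kn; case: (ltngtP i j) => // lt.
  have : (i.+1 * i.+1 <= j * j)%N by rewrite leq_mul.
  by nia.
have : (j.+1 * j.+1 <= i * i)%N by rewrite leq_mul.
by nia.
Qed.

(** A far window contains at most one hit position, a square. If there is one,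
    translating it to the square of [n.+1] gives a near window with the same
    pattern; if there is none, a negative position does. *)
Lemma far_window (n : nat) p : (near_radius n)%:Z < `|p| ->
  exists p' j, [/\ `|p'| <= (near_radius n)%:Z,
    forall k, `|k| <= n%:Z -> forall i, hit i (p + k) = hit i (p' + k)
  & forall k, `|k| <= n%:Z ->
     ~~ hit 1 (p + k) /\ (hit 2 (p + k) -> label (p + k) = j)].
Proof.
rewrite /near_radius => farp.
have hitn i z : z < 0 -> hit i z = false by case: z.
have h1 k : `|k| <= n%:Z -> hit 1 (p + k) = false by rewrite hit1E; lia.
case: (boolp.pselect (exists k, `|k| <= n%:Z /\ hit 2 (p + k))); last first.
  move=> no; have h2 k : `|k| <= n%:Z -> hit 2 (p + k) = false.
    by move=> kn; apply/negP => hk; apply: no; exists k.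
  exists (- (n.+1 * n.+1 + n)%N%:Z), 0%N; split; first lia.
    move=> k kn i; rewrite hitE h1 // h2 // !andbF hitn //; lia.
  by move=> k kn; rewrite h1 // h2.
case=> k [kn /hit2P[j pk]].
have nj : (n < j)%N by nia.
have single z : forall k' : int, `|k'| <= n%:Z -> (n < z)%N ->
    hit 2 ((z * z)%N%:Z - k + k') = (k' == k).
  move=> k' k'n nz; apply/hit2P/eqP => [[i iE]|->]; last by exists z; lia.
  have iz : i = z by apply: (@square_window _ _ n (k' - k)); lia.
  by subst i; lia.
exists ((n.+1 * n.+1)%N%:Z - k), j; split; first lia.
  move=> k' k'n i.
  have h1' : hit 1 ((n.+1 * n.+1)%N%:Z - k + k') = false.
    by rewrite hit1E; apply/negP => /eqP; nia.
  have pE : p = (j * j)%N%:Z - k by lia.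
  by rewrite hitE [RHS]hitE h1 // h1' pE !single.
move=> k' k'n; rewrite h1 //; split=> //.
have pE : p = (j * j)%N%:Z - k by lia.
rewrite pE single // => /eqP->.
by rewrite GRing.subrK label_square.
Qed.

End Generators.

(** * Deciding triviality from finitely many positions *)

Section Decision.
Variables (H : groupType) (y : nat -> H).
Local Open Scope ring_scope.

(** With [skip = false] this says that the element is 1; with [skip = true],
    that it belongs to the copy of H at the position (0, 0). *)
Definition almost_trivial (skip : bool) (g : wreath H) : Prop :=
  [/\ shift g = 0, forall p, turn g p = 0
    & forall p q, ~~ [&& skip, p == 0 & q == 0] -> fibre g p q = 1%g].

(** Words are tested at finitely many positions. For p far, the effect on q is
    seen at a near position by [eq_turn], and then the effect on h is trivial
    by [fibre_single]. For q far, q keeps its sign along the word, as does the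
    extreme tested value on the same side, so [eq_fibre] applies. *)
Lemma trivial_near skip cs (g := value (gen y) cs) (n := size cs) :
  (forall p q : int, `|p| <= (near_radius n)%:Z -> `|q| <= (n.+1)%:Z ->
     [/\ shift g = 0, turn g p = 0
       & ~~ [&& skip, p == 0 & q == 0] -> fibre g p q = 1%g]) ->
  almost_trivial skip g.
Proof.
move=> tr; have turn0 p : turn g p = 0.
  case: (lerP `|p| (near_radius n)%:Z) => [np|fp].
    by have [] := tr p 0 np isT.
  have [p' [j [np' hp' _]]] := far_window fp.
  by rewrite /g (eq_turn y hp'); have [] := tr p' 0 np' isT.
split=> // [|p q]; first by have [] := tr 0 0 isT isT.
case: (lerP `|p| (near_radius n)%:Z) => [np|fp] pq; last first.
  have [p' [j [_ _ hp]]] := far_window fp.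
  by rewrite /g (fibre_single y q hp) -/g turn0 GRing.addr0 mulVg.
case: (lerP `|q| (n.+1)%:Z) => [nq|fq]; first by have [_ _ ->] := tr p q np nq.
pose q' := if 0 <= q then (n.+1)%:Z else - (n.+1)%:Z.
have nq' : `|q'| <= (n.+1)%:Z by rewrite /q'; case: ifP; lia.
have -> : fibre g p q = fibre g p q'.
  apply: eq_fibre => k; rewrite -/n /q' => kn.
  by case: ifP => q0; apply/idP/idP; lia.
have [_ _ ->] // := tr p q' np nq'.
have -> : (q' == 0) = false by rewrite /q'; case: ifP; lia.
by rewrite !andbF.
Qed.

(** Given by cases for the same reason as [nonneg], like [pred_int] below. *)
Definition succ_int (z : int) : int :=
  match z with
  | Posz n => Posz n.+1
  | Negz n => if n == 0%N then Posz 0 else Negz n.-1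
  end.

Definition pred_int (z : int) : int :=
  match z with
  | Posz n => if n == 0%N then Negz 0 else Posz n.-1
  | Negz n => Negz n.+1
  end.

Lemma succ_intE z : succ_int z = z + 1.
Proof. by case: z => [n|[|n]] /=; lia. Qed.

Lemma pred_intE z : pred_int z = z - 1.
Proof. by case: z => [[|n]|n] /=; lia. Qed.

(** One letter acting on the current p and q. The third component collects, in
    reverse order, the codes of the letters of H that multiply h. *)
Definition run_step (st : int * int * seq nat) (c : nat) :
    int * int * seq nat :=
  if c./2 == 0%N then
    ((if odd c then pred_int st.1.1 else succ_int st.1.1), st.1.2, st.2)
  else if hit c./2 st.1.1 then
    (st.1.1, if odd c then pred_int st.1.2 else succ_int st.1.2,
     if nonneg (if odd c then pred_int st.1.2 else st.1.2) then
       (if odd c then ((label st.1.1).*2).+1 else (label st.1.1).*2) :: st.2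
     else st.2)
  else st.

Definition run_from (p q : int) (cs : seq nat) :=
  foldl run_step (p, q, [::]) cs.

Lemma run_fromP p q cs (g := value (gen y) cs) (st := run_from p q cs) :
  [/\ st.1.1 = p + shift g, st.1.2 = q + turn g p
    & value y (rev st.2) = fibre g p q].
Proof.
rewrite /st /run_from; set o := [::].
suff: let st := foldl run_step (p, q, o) cs in
   [/\ st.1.1 = p + shift g, st.1.2 = q + turn g p
     & value y (rev st.2) = (value y (rev o) * fibre g p q)%g].
  by move=> /= [-> -> ->]; rewrite value_nil mul1g.
rewrite /g {st g}; elim: cs p q o => [|c cs IHcs] p q o /=.
  by rewrite value_nil !GRing.addr0 mulg1.
rewrite value_letter !wreathE !GRing.addrA mulgA.
have [p1 q1 o1] : let st := run_step (p, q, o) c in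
    [/\ st.1.1 = p + shift (letter_gen y c),
        st.1.2 = q + turn (letter_gen y c) p
      & value y (rev st.2) = (value y (rev o) * fibre (letter_gen y c) p q)%g].
  rewrite shift_letter turn_letter fibre_letter /run_step /=.
  case: (c./2 =P 0%N) => [->|_] /=.
    rewrite hit0 GRing.addr0 mulg1; split=> //.
    by case: odd; rewrite ?succ_intE ?pred_intE.
  case: hit => /=; last by rewrite !GRing.addr0 mulg1.
  rewrite GRing.addr0 !pred_intE succ_intE; split=> //; first by case: odd.
  case: ifP => _; last by rewrite mulg1.
  rewrite rev_cons -cats1 value_cat value_cons value_nil mulg1.
  by case: (odd c); rewrite /= ?odd_double ?uphalf_double ?doubleK.
move: p1 q1 o1; case: (run_step (p, q, o) c) => -[p1 q1] o1 /= -> -> o1E.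
by have [-> -> ->] := IHcs (p + shift (letter_gen y c))
  (q + turn (letter_gen y c) p) o1; rewrite o1E.
Qed.

Definition int_range (N : nat) : seq int :=
  iter N (fun s => Posz (size s)./2 :: Negz (size s)./2 :: s) [::].

Lemma mem_int_range N (z : int) : - N%:Z <= z < N%:Z -> z \in int_range N.
Proof.
have sz n : size (int_range n) = n.*2 by elim: n => //= n ->.
elim: N => [|N IHN] zN /=; first by lia.
rewrite !inE sz doubleK.
case: (boolP (- N%:Z <= z < N%:Z)) => [/IHN->|zN']; first by rewrite !orbT.
apply/or3P; case: (lerP 0 z) => z0; [apply: Or31 | apply: Or32]; apply/eqP.
  by lia.
by rewrite NegzE; lia.
Qed.

Variable chi : seq nat -> bool.
Hypothesis cchi : computable chi.
Hypothesis chiP : forall cs, value y cs = 1%g <-> chi cs.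

Definition decide (skip : bool) (cs : seq nat) : bool :=
  all (fun p => all (fun q =>
    let st := run_from p q cs in
    [&& st.1.1 == p, st.1.2 == q
      & [&& skip, p == 0 & q == 0] || chi (rev st.2)])
    (int_range (size cs).+2)) (int_range (near_radius (size cs)).+1).

Lemma decideP skip cs :
  almost_trivial skip (value (gen y) cs) <-> decide skip cs.
Proof.
split=> [[s0 t0 f0]|/allP dec].
  apply/allP => p _; apply/allP => q _ /=.
  have [-> -> val] := run_fromP p q cs; rewrite s0 t0 !GRing.addr0 !eqxx /=.
  apply/orP; case: (boolP [&& _, _ & _]) => [|/f0 f1]; first by left.
  by right; apply/chiP; rewrite val.
apply: trivial_near => p q np nq.
have /dec /allP pdec : p \in int_range (near_radius (size cs)).+1.
  by apply: mem_int_range; lia.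
have /pdec /= : q \in int_range (size cs).+2 by apply: mem_int_range; lia.
have [-> -> val] := run_fromP p q cs => /and3P[/eqP pE /eqP qE pq].
split; [lia|lia|move=> npq].
by move: pq; rewrite (negbTE npq) /= -val => /chiP.
Qed.

Lemma computable_near : computable near_radius.
Proof. by rewrite /near_radius; computable_tac. Qed.

Lemma computable_isqrt : computable isqrt.
Proof. by rewrite /isqrt; computable_tac. Qed.

Lemma computable_label : computable label.
Proof.
have cr := computable_isqrt.
by apply: (computable_int_case (z := id)); computable_tac.
Qed.

Lemma computable_hit : computable (fun u : nat * int => hit u.1 u.2).
Proof.
have cr := computable_isqrt.
apply: (@computable_int_case _ _ snd (fun u n =>
  if u.1 == 1%N then n == 0%N else
  if u.1 == 2%N then isqrt n * isqrt n == n else false)%N (fun _ _ => false));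
  by computable_tac.
Qed.

Lemma computable_nonneg : computable nonneg.
Proof. by apply: (computable_int_case (z := id)); computable_tac. Qed.

Lemma computable_succ_int : computable succ_int.
Proof. by apply: (computable_int_case (z := id)); computable_tac. Qed.

Lemma computable_pred_int : computable pred_int.
Proof. by apply: (computable_int_case (z := id)); computable_tac. Qed.

Lemma computable_int_range : computable int_range.
Proof.
by rewrite /int_range; computable_tac; apply: computable_size; computable_tac.
Qed.

Lemma computable_run_from :
  computable (fun u : int * int * seq nat => run_from u.1.1 u.1.2 u.2).
Proof.
have cl := computable_label; have ch := computable_hit.
have cn := computable_nonneg; have cs := computable_succ_int.
have cp := computable_pred_int.
rewrite /run_from /run_step; computable_tac.
pose state := (int * int * seq nat)%type.
apply: (computable_comp (f := fun u : state * state * nat =>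
  (u.2./2, u.1.2.1.1)) ch).
by computable_tac.
Qed.

Lemma computable_decide skip : computable (decide skip).
Proof.
have cn := computable_near; have cr := computable_int_range.
have ct : computable (fun u : seq nat * int * int => run_from u.1.2 u.2 u.1.1).
  apply: (computable_comp (f := fun u : seq nat * int * int =>
    (u.1.2, u.2, u.1.1)) computable_run_from).
  by computable_tac.
rewrite /decide; apply: (computable_all (p := fun cs p => _)); last first.
  by computable_tac; apply: computable_size; computable_tac.
apply: (computable_all (p := fun u q => _)); last first.
  by computable_tac; apply: computable_size; computable_tac.
by computable_tac; apply: computable_rev; computable_tac.
Qed.

End Decision.

(** * The embedding *)

Section Embedding.
Variables (H : groupType).
Local Open Scope group_scope.

(** G is the subgroup generated by the three generators, and K its intersection
    with the copy of H, which G contains entirely. The chain below K consists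
    of the elements that fix p and fix q at p = 0, of those that fix p, and of
    G. Conjugation by an element of the first of these acts on the copy of H as
    conjugation by its value at (0, 0), whence the normality of K. *)
Lemma computable_group_embedding : computable_group H ->
  exists (G : groupType) (K : {pred G}),
     [/\ isomorphic_to_subgroup H K,
         subnormal_subgroup K,
         finitely_generated G,
         decidable_word_problem G
       & decidable_membership K].
Proof.
move=> /computable_group_pointed_sequence [y [y0 geny [chi cchi chiP]]].
pose delta : {multiplicative H -> wreath H} := @point_mass H.
have [G [iota [r [iota_inj genr iotar]]]] :=
  generated_subgroup (fun i : 'I_3 => gen y i).
(* From 3 on, no position is hit, so the family of generators is 1 there. *)
have iotaE cs : iota (value (extend r) cs) = value (gen y) cs.
  rewrite value_morph; apply: eq_value => i; rewrite /extend.
  case: insubP => /= [j _ <-|i3]; first exact: iotar.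
  rewrite multiplicative1; apply: wreath_eq => [|p|p q].
  - by rewrite shift_gen; case: eqP i3 => // ->.
  - by rewrite turn_gen hitE; case: i i3 => [|[|[|i]]].
  - by rewrite fibre_gen hitE; case: i i3 => [|[|[|i]]].
have iota_gen w : iota (word_eval r w) =
    value (gen y) (letter_codes (@nat_of_ord 3) w).
  by rewrite -iotaE value_extend.
pose K : {pred G} := fun g => boolp.asbool (exists h, point_mass h = iota g).
have KP g : reflect (exists h, point_mass h = iota g) (g \in K).
  exact: boolp.asboolP.
have phi_exists h : exists g, iota g = point_mass h.
  have [th thE] := boolp.choice (point_mass_gen y0).
  have [cs <-] := geny h.
  exists (value (extend r) (substitute th cs)).
  rewrite iotaE value_substitute (value_morph delta).
  exact: eq_value.
have [phi phiE] := boolp.choice phi_exists.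
have phiM : {morph phi : g h / g * h}.
  by move=> g h; apply: iota_inj; rewrite gmulfM !phiE point_massM.
pose phi' : {multiplicative H -> G} :=
  HB.pack phi (isMultiplicative.Build H G phi phiM).
have closedK : group_closed K.
  split.
    apply/KP; exists 1; rewrite multiplicative1.
    exact: (multiplicative1 delta).
  move=> g h /KP[a aE] /KP[b bE]; apply/KP; exists (a / b).
  rewrite [RHS]gmulfM [in RHS]multiplicativeV -aE -bE.
  by rewrite point_massM (multiplicativeV delta).
have decK skip : recursive_language (@nat_of_ord 3)
    (fun w => almost_trivial skip (iota (word_eval r w))).
  apply/recursive_languageP; exists (decide chi skip).
    exact: computable_decide.
  by move=> w; rewrite iota_gen; apply: decideP.
have ext_lang (L M : word 'I_3 -> Prop) : (forall w, L w <-> M w) ->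
    recursive_language (@nat_of_ord 3) L ->
    recursive_language (@nat_of_ord 3) M.
  by move=> LM [c rc cL]; exists c => // w; rewrite -LM.
exists G, K; split.
- split=> //; exists phi'; split.
    by move=> g h /(congr1 iota); rewrite /= !phiE => /point_mass_inj.
  move=> g; split=> [/KP[h hE]|[h <-]].
    by exists h; apply: iota_inj; rewrite /= phiE.
  by apply/KP; exists h; rewrite phiE.
- pose C i : {pred G} := fun g => match i with
    | 0 => g \in K
    | 1 => (shift (iota g) == 0%R) && (turn (iota g) 0%R == 0%R)
    | 2 => shift (iota g) == 0%R
    | _ => true end.
  exists 3, C; split=> //.
  have C1P g :
      reflect (shift (iota g) = 0%R /\ turn (iota g) 0%R = 0%R) (g \in C 1%N).
    by apply: (iffP andP) => -[/eqP ? /eqP ?].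
  have C2P g : reflect (shift (iota g) = 0%R) (g \in C 2%N) by exact: eqP.
  have c1 : group_closed (C 1%N).
    split; first by apply/C1P; rewrite multiplicative1.
    move=> g h /C1P[sg tg] /C1P[sh th]; apply/C1P.
    by rewrite gmulfM multiplicativeV !(wreathE, sg, sh, tg, th, GRing.subr0).
  have c2 : group_closed (C 2%N).
    split; first by apply/C2P; rewrite multiplicative1.
    move=> g h /C2P sg /C2P sh; apply/C2P.
    by rewrite gmulfM multiplicativeV !wreathE sg sh.
  move=> [|[|[|i]]] // _; split=> //.
  + by move=> g /KP[h hE]; apply/C1P; rewrite -hE.
  + move=> g h /KP[a aE] /C1P[sh th]; apply/KP.
    exists (a ^ fibre (iota h) 0%R 0%R).
    apply: (@mulgI _ (iota h)); rewrite -gmulfM -conjgC gmulfM -aE.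
    apply: wreath_eq => [|p|p q].
    * by rewrite !wreathE sh.
    * by rewrite !wreathE !GRing.addr0 GRing.add0r.
    rewrite !wreathE sh !GRing.addr0 /=.
    case: (eqVneq p 0%R) => [->|p0] /=; last by rewrite mul1g mulg1.
    rewrite th GRing.addr0; case: (eqVneq q 0%R) => [->|q0].
      by rewrite -conjgC.
    by rewrite mul1g mulg1.
  + by move=> g /C1P[sg _]; apply/C2P.
  + move=> g h /C1P[sg tg] /C2P sh; apply/C1P.
    rewrite conjgE !gmulfM multiplicativeV !wreathE sg sh.
    rewrite !GRing.oppr0 !GRing.addr0 tg; lia.
  + move=> g h /C2P sg _; apply/C2P.
    by rewrite conjgE !gmulfM multiplicativeV !wreathE sg; lia.
- by exists 3, r.
- exists 3, r; split=> //; apply: (ext_lang _ _ _ (decK false)) => w.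
  split=> [[s t f]|->]; last first.
    by rewrite multiplicative1; split.
  apply: iota_inj; rewrite multiplicative1; apply: wreath_eq => // p q.
  exact: f.
- exists 3, r; split=> //; apply: (ext_lang _ _ _ (decK true)) => w.
  split=> [[s t f]|/KP[h <-]]; last first.
    by split=> // p q /=; case: ifP.
  apply/KP; exists (fibre (iota (word_eval r w)) 0%R 0%R).
  apply: wreath_eq => [|p|p q] //=; rewrite ?s ?t //.
  case: (boolP (_ && _)) => [/andP[/eqP-> /eqP->] //|pq].
  by rewrite f.
Qed.

End Embedding.

Theorem corollary3 (H : groupType) (cntH : countable_group H) :
  (computable_group H <->
   exists (G : groupType) (K : {pred G}),
     [/\ isomorphic_to_subgroup H K,
         finitely_generated G,
         decidable_word_problem G
       & decidable_membership K])
  /\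
  (computable_group H <->
   exists (G : groupType) (K : {pred G}),
     [/\ isomorphic_to_subgroup H K,
         subnormal_subgroup K,
         finitely_generated G,
         decidable_word_problem G
       & decidable_membership K]).
Proof.
split; split.
- by move=> /computable_group_embedding [G [K [? ? ? ? ?]]]; exists G, K.
- move=> [G [K [iso _ dG dK]]].
  exact: computable_group_of_overgroup iso dG dK.
- exact: computable_group_embedding.
- move=> [G [K [iso _ _ dG dK]]].
  exact: computable_group_of_overgroup iso dG dK.
Qed.
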